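(* Let $a<b$ and let $U_n\subset C^n([a,b],\mathbb{K})$ (with $\mathbb{K}=\mathbb{R}$ or $\mathbb{C}$) be a $\mathbb{K}$-linear subspace of dimension $n+1$ which possesses a non-negative Bernstein basis $p_{n,0},\dots,p_{n,n}$ for $\{a,b\}$. Let $f_0\in U_n$ be strictly positive on $[a,b]$, and let $f_1\in U_n$ be such that $f_1/f_0$ is strictly increasing on $[a,b]$. Assume that $D_{f_0}U_n$ possesses a non-negative Bernstein basis $q_{n-1,0},\dots,q_{n-1,n-1}$ for $\{a,b\}$. If the coefficients $w_0,\dots,w_{n-1}$ defined by $$\frac{d}{dx}\frac{f_1}{f_0}=\sum_{k=0}^{n-1}w_k\,q_{n-1,k}$$ are all non-negative, then there exist points $t_0,\dots,t_n\in[a,b]$ with $t_0=a$ and $t_n=b$ and positive numbers $\alpha_0,\dots,\alpha_n$ such that the operator $B_n:C[a,b]\to U_n$, $B_nf=\sum_{k=0}^n f(t_k)\alpha_k p_{n,k}$, satisfies $B_nf_0=f_0$ and $B_nf_1=f_1$.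
   Context: A function $f\in C^m([a,b],\mathbb{K})$ has a zero of order (multiplicity) $k$ at a point $c\in[a,b]$ if $f(c)=f'(c)=\dots=f^{(k-1)}(c)=0$ and $f^{(k)}(c)\neq0$ (one-sided derivatives at endpoints). If $V\subset C^{m}([a,b],\mathbb{K})$ is a linear space of dimension $m+1$, a system $p_{m,0},\dots,p_{m,m}$ in $V$ is a Bernstein basis for $\{a,b\}$ if each $p_{m,k}$ has a zero of order exactly $k$ at $a$ and a zero of order exactly $m-k$ at $b$ (it is automatically a basis of $V$). It is non-negative if every $p_{m,k}$ is real-valued and $p_{m,k}(x)\ge 0$ for all $x\in[a,b]$. For a strictly positive (real-valued, $>0$) $f_0\in U_n$, the space of derivatives modulo $f_0$ is $D_{f_0}U_n=\{\frac{d}{dx}(f/f_0): f\in U_n\}$, an $n$-dimensional subspace of $C^{n-1}([a,b],\mathbb{K})$. *)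

(* Defs.v *)
(* reals from mathcomp-analysis (realType), complex numbers
   R[i] from mathcomp-real-closed.  The scalar field K is either R or R[i];
   iota : R -> K is the canonical embedding (id, resp. x |-> x%:C).
   Limits (derivatives, continuity) are written out epsilon-delta using the
   norm of K, which works uniformly for K = R and K = C. *)
From HB Require Import structures.
From mathcomp Require Import all_boot all_order all_algebra.
From mathcomp Require Import reals.
From mathcomp Require Import complex.

Set Implicit Arguments.
Unset Strict Implicit.
Unset Printing Implicit Defensive.

Import Order.TTheory GRing.Theory Num.Theory.
Local Open Scope ring_scope.

Section Defs.
Variables (R : realType) (K : numFieldType) (iota : R -> K).

Definition deriv_within (a b : R) (f g : R -> K) : Prop :=
  forall x, a <= x <= b -> forall e : R, 0 < e -> exists2 d : R, 0 < d &
    forall y, a <= y <= b -> y != x -> `|y - x| < d ->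
      `|(f y - f x) / iota (y - x) - g x| < iota e.

Definition cont_within (a b : R) (g : R -> K) : Prop :=
  forall x, a <= x <= b -> forall e : R, 0 < e -> exists2 d : R, 0 < d &
    forall y, a <= y <= b -> `|y - x| < d -> `|g y - g x| < iota e.

Definition Cm_on (a b : R) (m : nat) (f : R -> K) : Prop :=
  exists d : nat -> R -> K,
    [/\ forall x, a <= x <= b -> d 0%N x = f x,
        forall j, (j < m)%N -> deriv_within a b (d j) (d j.+1) &
        forall j, (j <= m)%N -> cont_within a b (d j)].

Definition zero_of_order (a b : R) (f : R -> K) (k : nat) (c : R) : Prop :=
  exists d : nat -> R -> K,
    [/\ forall x, a <= x <= b -> d 0%N x = f x,
        forall j, (j < k)%N -> deriv_within a b (d j) (d j.+1),
        forall j, (j < k)%N -> d j c = 0 &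
        d k c != 0].

Definition is_subspace (V : (R -> K) -> Prop) : Prop :=
  [/\ V (fun _ => 0),
      forall f g, V f -> V g -> V (fun x => f x + g x) &
      forall (c : K) f, V f -> V (fun x => c * f x)].

Definition has_dim (a b : R) (V : (R -> K) -> Prop) (N : nat) : Prop :=
  exists e : 'I_N -> R -> K,
    [/\ forall k, V (e k),
        forall c : 'I_N -> K,
          (forall x, a <= x <= b -> \sum_(k < N) c k * e k x = 0) ->
          forall k, c k = 0 &
        forall f, V f -> exists c : 'I_N -> K,
          forall x, a <= x <= b -> f x = \sum_(k < N) c k * e k x].

(* p_{m,0}, ..., p_{m,m} (with N = m + 1 functions) is a Bernstein basis
   for {a,b} in V: each p_{m,k} lies in V and has a zero of order exactly k
   at a and exactly m - k at b. *)
Definition bernstein_basis (a b : R) (V : (R -> K) -> Prop) (N : nat)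
    (p : 'I_N -> R -> K) : Prop :=
  forall k : 'I_N,
    [/\ V (p k), zero_of_order a b (p k) k a & zero_of_order a b (p k) (N.-1 - k) b].

(* non-negative: every p k is real-valued and >= 0 on [a,b]
   (for K = C, 0 <= z means z is real and non-negative) *)
Definition nonneg_family (a b : R) (N : nat) (p : 'I_N -> R -> K) : Prop :=
  forall k x, a <= x <= b -> 0 <= p k x.

Definition deriv_mod (a b : R) (f0 : R -> K) (V : (R -> K) -> Prop) :
    (R -> K) -> Prop :=
  fun g => exists2 f, V f & deriv_within a b (fun x => f x / f0 x) g.

Definition bern_op (n : nat) (t alpha : 'I_n.+1 -> R) (p : 'I_n.+1 -> R -> K)
    (f : R -> K) : R -> K :=
  fun x => \sum_(k < n.+1) f (t k) * iota (alpha k) * p k x.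

Definition theorem1_for : Prop :=
  forall (a b : R) (n : nat) (U : (R -> K) -> Prop)
         (p : 'I_n.+1 -> R -> K) (f0 f1 : R -> K)
         (q : 'I_n -> R -> K) (w : 'I_n -> K),
    a < b ->
    is_subspace U ->
    (forall f, U f -> Cm_on a b n f) ->
    has_dim a b U n.+1 ->
    bernstein_basis a b U p ->
    nonneg_family a b p ->
    U f0 ->
    (forall x, a <= x <= b -> 0 < f0 x) ->
    U f1 ->
    (forall x, a <= x <= b -> f1 x \is Num.real) ->
    (forall x y, a <= x <= b -> a <= y <= b -> x < y ->
       f1 x / f0 x < f1 y / f0 y) ->
    bernstein_basis a b (deriv_mod a b f0 U) q ->
    nonneg_family a b q ->
    deriv_within a b (fun x => f1 x / f0 x)
                     (fun x => \sum_(k < n) w k * q k x) ->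
    (forall k, 0 <= w k) ->
    exists t alpha : 'I_n.+1 -> R,
      [/\ forall k, a <= t k <= b,
          t ord0 = a /\ t ord_max = b,
          forall k, 0 < alpha k,
          forall x, a <= x <= b -> bern_op t alpha p f0 x = f0 x &
          forall x, a <= x <= b -> bern_op t alpha p f1 x = f1 x].

End Defs.

(* Main.v *)
(** Write [f0 = \sum_j beta_j p_j] and let [psi_k] be the primitive of [q_k]
    vanishing at [a], so that [f0 * psi_k] belongs to [U].  Put
    [C_k = psi_k b > 0].  The function [f0 * psi_k] vanishes to order [k + 1]
    at [a], and [f0 * (psi_k - C_k)] vanishes to order [n - k] at [b]; comparing
    Bernstein coefficients gives [f0 * psi_k = C_k * \sum_(j > k) beta_j p_j].
    Looking at the leading term at [a], where everything is non-negative,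
    [beta_(k+1) > 0].  Integrating the expansion of [(f1 / f0)'] yields
    [f1 = \sum_j rho_j beta_j p_j] with
    [rho_j = (f1 / f0) a + \sum_(k < j) w_k C_k], a nondecreasing sequence going
    from [(f1 / f0) a] to [(f1 / f0) b].  The intermediate value theorem provides
    [t_j] with [(f1 / f0) t_j = rho_j], and [alpha_j = beta_j / f0 t_j].
    The complex case reduces to the real one by taking real parts. *)
Require Import Defs.
From HB Require Import structures.
From mathcomp Require Import all_boot all_order all_algebra.
From mathcomp Require Import reals.
From mathcomp Require Import complex.
From mathcomp Require Import boolp classical_sets topology normedtype derive.
From mathcomp Require Import ring lra.

Set Implicit Arguments.
Unset Strict Implicit.
Unset Printing Implicit Defensive.

Import Order.TTheory GRing.Theory Num.Theory.
Import numFieldNormedType.Exports.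
Local Open Scope ring_scope.

(** * Leading-order expansions at a point of the interval *)

Section Asymptotics.
Variables (R : realType) (a b : R).
Hypothesis ltab : a < b.
Implicit Types (f g F : R -> R) (c L M x y : R) (j k m : nat).

(* [f y = (L + o(1)) (y - c) ^+ k] as [y] tends to [c] inside [a, b] *)
Definition asym f k c L : Prop :=
  forall e : R, 0 < e -> exists2 d : R, 0 < d &
    forall y, a <= y <= b -> `|y - c| < d ->
      `|f y - L * (y - c) ^+ k| <= e * `|y - c| ^+ k.

Local Notation deriv_on := (deriv_within (K := R) (fun x : R => x) a b).
Local Notation cont_on := (cont_within (K := R) (fun x : R => x) a b).
Local Notation zero_on := (zero_of_order (K := R) (fun x : R => x) a b).

Lemma eq_asym f g k c L : (forall y, a <= y <= b -> f y = g y) ->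
  asym f k c L -> asym g k c L.
Proof.
move=> fg hf e e0; have [d d0 hd] := hf e e0.
by exists d => // y yab yc; rewrite -fg //; exact: hd.
Qed.

Lemma asymD f g k c L M : asym f k c L -> asym g k c M ->
  asym (fun y => f y + g y) k c (L + M).
Proof.
move=> hf hg e e0; have e20 : 0 < e / 2 by lra.
have [d d0 hd] := hf _ e20; have [d' d'0 hd'] := hg _ e20.
exists (Num.min d d'); first by rewrite lt_min d0.
move=> y yab; rewrite lt_min => /andP[y1 y2].
have := hd y yab y1; have := hd' y yab y2.
set u := `|_|; set v := `|f y - _| => hu hv.
have -> : f y + g y - (L + M) * (y - c) ^+ k =
  (f y - L * (y - c) ^+ k) + (g y - M * (y - c) ^+ k) by ring.
by apply: le_trans (ler_normD _ _) _; rewrite -/u -/v; lra.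
Qed.

Lemma asymZ s f k c L : asym f k c L -> asym (fun y => s * f y) k c (s * L).
Proof.
move=> hf e e0; have s0 : 0 < `|s| + 1 by have := normr_ge0 s; lra.
have [d d0 hd] := hf (e / (`|s| + 1)) (divr_gt0 e0 s0).
exists d => // y yab yc; have {hd} := hd y yab yc.
have -> : s * f y - s * L * (y - c) ^+ k = s * (f y - L * (y - c) ^+ k) by ring.
rewrite normrM.
set t := `|y - c| ^+ k; set u := `|_ - _| => hu.
have t0 : 0 <= t by rewrite exprn_ge0.
have : (`|s| + 1) * u <= e * t.
  have -> : e * t = (`|s| + 1) * (e / (`|s| + 1) * t) by field; lra.
  by rewrite ler_pM2l.
have : 0 <= u by exact: normr_ge0.
by lra.
Qed.

Lemma asym_cst0 k c : asym (fun=> 0) k c 0.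
Proof.
move=> e e0; exists 1 => // y _ _.
by rewrite mul0r subrr normr0 mulr_ge0 ?exprn_ge0 // ltW.
Qed.

Lemma asym_sum (I : finType) (f : I -> R -> R) k c (L : I -> R) :
  (forall i, asym (f i) k c (L i)) ->
  asym (fun y => \sum_i f i y) k c (\sum_i L i).
Proof.
move=> hf; elim: index_enum => [|i s IHs].
  rewrite big_nil; apply: eq_asym (asym_cst0 k c) => y _.
  by rewrite big_nil.
rewrite big_cons; apply: eq_asym (asymD (hf i) IHs) => y _.
by rewrite big_cons.
Qed.

(** The error splits into [F y] times the error of [f], plus [F y - A] times the main term of [f].
    This allows passing from a quotient to its product with a continuous denominator at the same
    order. *)
Lemma asymM F f k c A L : asym F 0 c A -> asym f k c L ->
  asym (fun y => F y * f y) k c (A * L).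
Proof.
move=> hF hf e e0.
pose e1 := e / (`|L| + 1) / 2.
have L0 : 0 < `|L| + 1 by have := normr_ge0 L; lra.
have e10 : 0 < e1 by rewrite !divr_gt0.
have A0 : 0 < `|A| + 1 by have := normr_ge0 A; lra.
have e20 : 0 < e / (`|A| + 1) / 2 by rewrite !divr_gt0.
(* The bound [1] gives [|F y| <= |A| + 1]; the bound [e1] controls the term with [F y - A]. *)
have [d d0 hd] := hF (Num.min 1 e1) ltac:(by rewrite lt_min ltr01).
have [d' d'0 hd'] := hf _ e20.
exists (Num.min d d'); first by rewrite lt_min d0.
move=> y yab; rewrite lt_min => /andP[y1 y2].
have := hd y yab y1; rewrite !expr0 !mulr1 le_min => /andP[hF1 hF2].
have {hd hd'} := hd' y yab y2.
set t := `|y - c| ^+ k => h3.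
have -> : F y * f y - A * L * (y - c) ^+ k =
  F y * (f y - L * (y - c) ^+ k) + (F y - A) * (L * (y - c) ^+ k) by ring.
apply: le_trans (ler_normD _ _) _.
rewrite !normrM normrX -/t.
have t0 : 0 <= t by rewrite exprn_ge0.
have FA : `|F y| <= `|A| + 1.
  by have := ler_normD (F y - A) A; rewrite subrK; lra.
have B1 : `|F y| * `|f y - L * (y - c) ^+ k| <=
  (`|A| + 1) * (e / (`|A| + 1) / 2 * t) by exact: ler_pM.
have B2 : `|F y - A| * (`|L| * t) <= e1 * ((`|L| + 1) * t).
  by apply: ler_pM => //; [rewrite mulr_ge0|rewrite ler_wpM2r//; lra].
have -> : e * t = (`|A| + 1) * (e / (`|A| + 1) / 2 * t) + e1 * ((`|L| + 1) * t).
  by rewrite /e1; field; apply/andP; split; lra.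
by lra.
Qed.

Lemma asym_lt f k j c L : (j < k)%N -> asym f k c L -> asym f j c 0.
Proof.
move=> jk hf e e0; have [d d0 hd] := hf 1 ltr01.
have L0 : 0 < `|L| + 1 by have := normr_ge0 L; lra.
(* The bound [1] reduces the surplus powers of [|y - c|] to a single factor, which the last bound
   makes small. *)
exists (Num.min d (Num.min 1 (e / (`|L| + 1)))).
  by rewrite !lt_min d0 ltr01 divr_gt0.
move=> y yab; rewrite !lt_min => /and3P[y1 y2 y3]; rewrite mul0r subr0.
have {hd} := hd y yab y1; rewrite mul1r => hy.
have f1 : `|f y| <= (`|L| + 1) * `|y - c| ^+ k.
  have := ler_normD (f y - L * (y - c) ^+ k) (L * (y - c) ^+ k).
  by rewrite subrK normrM normrX; lra.
apply: le_trans f1 _.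
have -> : e * `|y - c| ^+ j = (`|L| + 1) * (e / (`|L| + 1) * `|y - c| ^+ j).
  by field; lra.
rewrite ler_pM2l // -(subnK jk) addnS exprS exprD.
apply: ler_pM; rewrite ?mulr_ge0 ?exprn_ge0 //; first exact: ltW.
by rewrite ler_piMl ?exprn_ge0 // exprn_ile1 // ltW.
Qed.

(** Uniqueness and sign of leading coefficients need a test point other than [c]; it is taken to the
    right of [c], except at [b]. *)
Lemma interval_point_near c d : a <= c <= b -> 0 < d ->
  exists y, [/\ a <= y <= b, y != c & `|y - c| < d].
Proof.
move=> /andP[ac cb] d0.
have [cltb|bc] := ltP c b.
  pose m := Num.min (d / 2) (b - c).
  have m0 : 0 < m by rewrite lt_min; apply/andP; split; lra.
  have m1 : m <= d / 2 by rewrite ge_min lexx.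
  have m2 : m <= b - c by rewrite ge_min lexx orbT.
  exists (c + m); split; first by apply/andP; split; lra.
    by apply/eqP; lra.
  have -> : c + m - c = m by ring.
  by rewrite gtr0_norm //; lra.
pose m := Num.min (d / 2) (c - a).
have m0 : 0 < m by move: ltab; rewrite lt_min => altb; apply/andP; split; lra.
have m1 : m <= d / 2 by rewrite ge_min lexx.
have m2 : m <= c - a by rewrite ge_min lexx orbT.
exists (c - m); split; first by apply/andP; split; lra.
  by apply/eqP; lra.
have -> : c - m - c = - m by ring.
by rewrite normrN gtr0_norm //; lra.
Qed.

Lemma asym_uniq f k c L M : a <= c <= b ->
  asym f k c L -> asym f k c M -> L = M.
Proof.
move=> cab hL hM; apply/eqP/negPn/negP => LM.
have LM0 : 0 < `|L - M| by rewrite normr_gt0 subr_eq0.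
have e0 : 0 < `|L - M| / 3 by lra.
have [d d0 hd] := hL _ e0; have [d' d'0 hd'] := hM _ e0.
have [|y [yab yc]] := @interval_point_near c (Num.min d d') cab.
  by rewrite lt_min d0.
rewrite lt_min => /andP[y1 y2].
have := hd y yab y1; have := hd' y yab y2.
set t := `|y - c| ^+ k => h1 h2.
have t0 : 0 < t by rewrite exprn_gt0 // normr_gt0 subr_eq0.
have : `|L - M| * t <= `|L - M| / 3 * t + `|L - M| / 3 * t.
  rewrite /t -normrX -normrM normrX -/t.
  have -> : (L - M) * (y - c) ^+ k =
    (f y - M * (y - c) ^+ k) - (f y - L * (y - c) ^+ k) by ring.
  by apply: le_trans (ler_normB _ _) _; exact: lerD.
have : 0 < `|L - M| * t by exact: mulr_gt0.
by lra.
Qed.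

(** The left endpoint matters: [(y - a) ^+ k] is positive for every [k], whereas the sign of
    [(y - b) ^+ k] depends on the parity of [k]. *)
Lemma asym_ge0 f k L : (forall y, a <= y <= b -> 0 <= f y) ->
  asym f k a L -> 0 <= L.
Proof.
move=> f0 hf; rewrite leNgt; apply/negP => L0.
have e0 : 0 < - L / 2 by lra.
have [d d0 hd] := hf _ e0.
have aab : a <= a <= b by rewrite lexx ltW.
have [y [yab ya yd]] := interval_point_near aab d0.
have := hd y yab yd.
have ya0 : 0 <= y - a by case/andP: yab; lra.
rewrite (ger0_norm ya0).
have t0 : 0 < (y - a) ^+ k.
  by rewrite exprn_gt0 // lt_neqAle ya0 andbT eq_sym subr_eq0.
set t := (y - a) ^+ k in t0 * => h.
have := ler_norm (f y - L * t); have := f0 y yab.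
have : 0 < - L * t by rewrite mulr_gt0 //; lra.
by lra.
Qed.

(** * Differential calculus on the closed interval and Taylor expansion *)

Lemma deriv_on_asym f g :
  deriv_on f g <->
  forall x, a <= x <= b -> asym (fun y => f y - f x) 1 x (g x).
Proof.
split=> [hf x xab e e0|hf x xab e e0].
  have [d d0 hd] := hf x xab e e0; exists d => // y yab yx.
  have [->|ynx] := eqVneq y x; first by rewrite !subrr !expr1 !mulr0 subrr normr0 mulr0.
  have yx0 : y - x != 0 by rewrite subr_eq0.
  have /ltW := hd y yab ynx yx.
  rewrite !expr1.
  have -> : f y - f x - g x * (y - x) = ((f y - f x) / (y - x) - g x) * (y - x).
    by field.
  by rewrite normrM ler_pM2r // normr_gt0.
have e20 : 0 < e / 2 by lra.
have [d d0 hd] := hf x xab _ e20; exists d => // y yab ynx yx.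
have yx0 : y - x != 0 by rewrite subr_eq0.
have := hd y yab yx; rewrite !expr1.
have -> : f y - f x - g x * (y - x) = ((f y - f x) / (y - x) - g x) * (y - x).
  by field.
by rewrite normrM ler_pM2r ?normr_gt0 //; lra.
Qed.

Lemma cont_on_asym f :
  cont_on f <-> forall x, a <= x <= b -> asym f 0 x (f x).
Proof.
split=> [hf x xab e e0|hf x xab e e0].
  have [d d0 hd] := hf x xab e e0; exists d => // y yab yx.
  by rewrite !expr0 !mulr1 ltW // hd.
have e20 : 0 < e / 2 by lra.
have [d d0 hd] := hf x xab _ e20; exists d => // y yab yx.
by have := hd y yab yx; rewrite !expr0 !mulr1; lra.
Qed.

Lemma eq_deriv_on f f' g g' :
  (forall x, a <= x <= b -> f x = f' x) ->
  (forall x, a <= x <= b -> g x = g' x) -> deriv_on f g -> deriv_on f' g'.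
Proof.
move=> ff gg hf x xab e e0; have [d d0 hd] := hf x xab e e0.
by exists d => // y yab; rewrite -!ff // -gg //; exact: hd.
Qed.

Lemma deriv_onD f f' g g' : deriv_on f g -> deriv_on f' g' ->
  deriv_on (fun x => f x + f' x) (fun x => g x + g' x).
Proof.
move=> /deriv_on_asym hf /deriv_on_asym hg; apply/deriv_on_asym => x xab.
by apply: eq_asym (asymD (hf x xab) (hg x xab)) => y _; ring.
Qed.

Lemma deriv_onZ s f g : deriv_on f g ->
  deriv_on (fun x => s * f x) (fun x => s * g x).
Proof.
move=> /deriv_on_asym hf; apply/deriv_on_asym => x xab.
by apply: eq_asym (asymZ s (hf x xab)) => y _; ring.
Qed.

Lemma deriv_on_cst s : deriv_on (fun=> s) (fun=> 0).
Proof.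
apply/deriv_on_asym => x _.
by apply: eq_asym (asym_cst0 1 x) => y _; rewrite subrr.
Qed.

Lemma deriv_on_sum (I : finType) (f g : I -> R -> R) :
  (forall i, deriv_on (f i) (g i)) ->
  deriv_on (fun x => \sum_i f i x) (fun x => \sum_i g i x).
Proof.
move=> hf; apply/deriv_on_asym => x xab.
have h i : asym (fun y => f i y - f i x) 1 x (g i x).
  by have /deriv_on_asym := hf i; exact.
by apply: eq_asym (asym_sum h) => y _; rewrite sumrB.
Qed.

Lemma deriv_on_uniq f g g' : deriv_on f g -> deriv_on f g' ->
  forall x, a <= x <= b -> g x = g' x.
Proof.
move=> /deriv_on_asym hg /deriv_on_asym hg' x xab.
exact: asym_uniq (hg x xab) (hg' x xab).
Qed.

Lemma deriv_on_cont f g : deriv_on f g -> cont_on f.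
Proof.
move=> /deriv_on_asym hf; apply/cont_on_asym => x xab e e0.
have [d d0 hd] := asym_lt (ltnSn 0) (hf x xab) e0.
by exists d => // y yab yx; have := hd y yab yx; rewrite mul0r subr0 expr0 !mulr1.
Qed.

(** Bridge to filter-based continuity, so that the mean value and intermediate value theorems
    apply. *)
Lemma cont_on_within f u v : a <= u -> v <= b -> cont_on f ->
  {within `[u, v], continuous f}%classic.
Proof.
move=> au vb hf; apply/subspace_continuousP => x /=.
rewrite in_itv /= => /andP[ux xv].
apply/cvgrPdist_lt => e e0.
have [|d d0 hd] := hf x _ e e0; first by apply/andP; split; lra.
rewrite near_withinE; apply/nbhs_ballP; exists d => //= y yx.
rewrite in_itv /= => /andP[uy yv]; rewrite distrC; apply: hd.
  by apply/andP; split; lra.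
by move: yx; rewrite /ball /= distrC.
Qed.

Lemma deriv_on_is_derive f g x : deriv_on f g -> a < x < b ->
  is_derive x 1 f (g x).
Proof.
move=> hf /andP[ax xb].
have H : (h^-1 *: ((f \o shift x) (h *: (1 : R)) - f x) @[h --> 0^'] --> g x)%classic.
  apply/cvgrPdist_lt => e e0.
  have [|d d0 hd] := hf x _ e e0; first by apply/andP; split; lra.
  exists (Num.min d (Num.min (x - a) (b - x))) => /=.
    by rewrite !lt_min d0 /= !subr_gt0 ax.
  move=> h /=; rewrite sub0r normrN !lt_min => /and3P[h1 h2 h3] h0.
  move: h2 h3; rewrite [`|h| < x - a]ltr_norml [`|h| < b - x]ltr_norml.
  move=> /andP[h4 h5] /andP[h6 h7].
  rewrite /= distrC /shift /= [h *: 1]mulr1 [h^-1 *: _]mulrC.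
  have := hd (h + x); have -> : h + x - x = h by ring.
  apply=> //; first by apply/andP; split; lra.
  by rewrite -subr_eq0 addrK.
split; first by apply/cvg_ex; exists (g x).
exact: cvg_lim.
Qed.

Lemma deriv_on_mvt f g x y : deriv_on f g -> a <= x -> x < y -> y <= b ->
  exists2 c, x < c < y & f y - f x = g c * (y - x).
Proof.
move=> hf ax xy yb.
have [||c] := @MVT R f g x y xy.
- move=> z; rewrite in_itv /= => /andP[xz zy].
  by apply: deriv_on_is_derive hf _; apply/andP; split; lra.
- exact: cont_on_within (deriv_on_cont hf).
by rewrite in_itv /= => cxy hc; exists c.
Qed.

Lemma deriv_on_pow c k :
  deriv_on (fun y => (y - c) ^+ k.+1) (fun y => k.+1%:R * (y - c) ^+ k).
Proof.
elim: k => [|k /deriv_on_asym IHk].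
  apply/deriv_on_asym => x xab e e0; exists 1 => // y _ _.
  have -> : (y - c) ^+ 1 - (x - c) ^+ 1 - 1%:R * (x - c) ^+ 0 * (y - x) ^+ 1 = 0.
    by ring.
  by rewrite normr0 mulr_ge0 ?exprn_ge0 // ltW.
apply/deriv_on_asym => x xab.
have id1 : asym (fun y => y - x) 1 x 1.
  move=> e e0; exists 1 => // y _ _.
  by rewrite mul1r expr1 subrr normr0 mulr_ge0 ?exprn_ge0 // ltW.
have cont_id : asym (fun y => y - c) 0 x (x - c).
  move=> e e0; exists e => // y _ yx.
  by rewrite !expr0 !mulr1 opprB addrA subrK ltW.
(* Product rule for [(y - c) * (y - c) ^+ k.+1]: the increment is [y - c] times the increment of the
   power, plus [(x - c) ^+ k.+1 * (y - x)]. *)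
have := asymD (asymM cont_id (IHk x xab)) (asymZ ((x - c) ^+ k.+1) id1).
have -> : (x - c) * (k.+1%:R * (x - c) ^+ k) + (x - c) ^+ k.+1 * 1 =
  k.+2%:R * (x - c) ^+ k.+1 by rewrite exprS -[k.+2%:R]natr1; ring.
by apply: eq_asym => y _; rewrite !exprS; ring.
Qed.

(* One step of Taylor's formula: an asymptotic expansion of the derivative integrates. *)
Lemma asym_integrate f g k c L : a <= c <= b -> f c = 0 -> deriv_on f g ->
  asym g k c L -> asym f k.+1 c (L / k.+1%:R).
Proof.
move=> cab fc hf hg e e0; have [d d0 hd] := hg e e0.
exists d => // y yab yc.
set M := L / k.+1%:R.
(* [G] is [f] minus its claimed leading term and its derivative is the remainder of [g], so the mean
   value theorem turns the bound on that remainder into one on [G]. *)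
pose G x := f x + - M * (x - c) ^+ k.+1.
have hG : deriv_on G (fun x => g x - L * (x - c) ^+ k).
  apply: eq_deriv_on (deriv_onD hf (deriv_onZ (- M) (deriv_on_pow c k))) => // x _.
  by rewrite /= -[L in RHS](@divfK _ k.+1%:R) ?pnatr_eq0 // -/M; ring.
have Gc : G c = 0 by rewrite /G fc subrr exprS mul0r mulr0 addr0.
have -> : f y - M * (y - c) ^+ k.+1 = G y - G c by rewrite Gc /G; ring.
have bound z : a <= z <= b -> `|z - c| <= `|y - c| ->
    `|(g z - L * (z - c) ^+ k) * (y - c)| <= e * `|y - c| ^+ k.+1.
  move=> zab zy; rewrite normrM exprSr mulrA ler_wpM2r //.
  apply: le_trans (hd z zab (le_lt_trans zy yc)) _.
  by rewrite ler_wpM2l ?(ltW e0) // lerXn2r // nnegrE.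
case/andP: (yab) => ay yb; case/andP: (cab) => ac cb.
have [yltc|clty|->] := ltgtP y c.
- have [z /andP[yz zc]] := deriv_on_mvt hG ay yltc cb.
  move=> E; have -> : G y - G c = - (G c - G y) by ring.
  rewrite E -mulrN opprB; apply: bound; first by apply/andP; split; lra.
  by rewrite !ler0_norm; lra.
- have [z /andP[cz zy] ->] := deriv_on_mvt hG ac clty yb.
  apply: bound; first by apply/andP; split; lra.
  by rewrite !ger0_norm; lra.
- by rewrite subrr normr0 mulr_ge0 ?exprn_ge0 // ltW.
Qed.

(** By Taylor's formula the coefficient is [d k c] divided by the factorial of [k]. At [k = 0] the
    chain [d] carries no differentiability, so continuity is supplied separately. *)
Lemma zero_on_asym f k c : a <= c <= b -> (k = 0 -> cont_on f)%N ->
  zero_on f k c -> exists2 L, L != 0 & asym f k c L.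
Proof.
move=> cab hc [d [d0 hd dc dk]].
suff [L L0 hL] : exists2 L, L != 0 & asym (d 0%N) k c L.
  by exists L => //; exact: eq_asym hL.
case: k => [|k] in hc hd dc dk *.
  exists (d 0%N c) => //; rewrite d0 //.
  have /cont_on_asym/(_ c cab) := hc erefl.
  by apply: eq_asym => y yab; rewrite d0.
move: hd dc dk {d0 hc}; elim: k d => [|k IHk] d hd dc dk.
  (* The induction starts at order one, with the derivative at [c] itself: the last function of the
     chain is not assumed continuous, so it has no order zero expansion to integrate. *)
  exists (d 1%N c) => //.
  have /deriv_on_asym/(_ c cab) := hd 0%N (ltnSn 0).
  by apply: eq_asym => y _; rewrite dc // subr0.
have [|||L L0 hL] := IHk (fun j => d j.+1).
- by move=> j jk; exact: hd.
- by move=> j jk; exact: dc.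
- exact: dk.
exists (L / k.+2%:R); first by rewrite mulf_neq0 // invr_eq0 pnatr_eq0.
by apply: asym_integrate hL => //; [exact: dc|exact: hd].
Qed.

(** * Coefficients read off from distinct vanishing orders *)

Section Coefficients.
Variables (N : nat) (P : 'I_N -> R -> R) (o : 'I_N -> nat) (c : R) (L : 'I_N -> R).
Hypothesis cab : a <= c <= b.
Hypothesis o_inj : injective o.
Hypothesis PL : forall j : 'I_N, asym (P j) (o j) c (L j).
Hypothesis L0 : forall j : 'I_N, L j != 0.

(** Terms of lower order have coefficient zero, terms of higher order are negligible, and
    injectivity of [o] leaves only the index [j] at order [o j]. *)
Lemma asym_leading_coef (u : 'I_N -> R) (j : 'I_N) :
  (forall i, (o i < o j)%N -> u i = 0) ->
  asym (fun y => \sum_i u i * P i y) (o j) c (u j * L j).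
Proof.
move=> hu.
have h i : asym (fun y => u i * P i y) (o j) c (if i == j then u j * L j else 0).
  have [->|ij] := eqVneq i j; first exact: asymZ.
  have [oij|oji|oij] := ltngtP (o i) (o j).
  - by apply: eq_asym (asym_cst0 (o j) c) => y _; rewrite hu // mul0r.
  - by rewrite -(mulr0 (u i)); apply/asymZ/(asym_lt oji).
  - by rewrite (o_inj oij) eqxx in ij.
by have := asym_sum h; rewrite -big_mkcond /= big_pred1_eq.
Qed.

(** Strong induction on the order: once the coefficients of smaller order vanish, [u j * L j] is the
    coefficient at order [o j < m], where the whole sum is negligible. *)
Lemma asym_coef0 (u : 'I_N -> R) m M :
  asym (fun y => \sum_i u i * P i y) m c M ->
  forall j : 'I_N, (o j < m)%N -> u j = 0.
Proof.
move=> hu j; have [k] := ubnP (o j); elim: k j => // k IHk j ojk ojm.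
have := @asym_leading_coef u j _.
move=> /(_ (fun i oij => IHk i (leq_trans oij ojk) (ltn_trans oij ojm))) h.
have /eqP := asym_uniq cab h (asym_lt ojm hu).
by rewrite mulf_eq0 (negPf (L0 j)) orbF => /eqP.
Qed.

End Coefficients.

End Asymptotics.

(** * The theorem over the reals, in Bernstein coordinates *)

Section RealCase.
Variables (R : realType) (a b : R).
Hypothesis ltab : a < b.

Local Notation deriv_on := (deriv_within (K := R) (fun x : R => x) a b).
Local Notation cont_on := (cont_within (K := R) (fun x : R => x) a b).
Local Notation zero_on := (zero_of_order (K := R) (fun x : R => x) a b).

Lemma deriv_on_nondecreasing (f g : R -> R) : deriv_on f g ->
  (forall x, a <= x <= b -> 0 <= g x) ->
  forall x y, a <= x -> x <= y -> y <= b -> f x <= f y.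
Proof.
move=> hf g0 x y ax; rewrite le_eqVlt => /predU1P[->//|xy] yb.
have [c /andP[xc cy] E] := deriv_on_mvt hf ax xy yb.
rewrite -subr_ge0 E mulr_ge0 ?subr_ge0 ?(ltW xy) // g0 //.
by apply/andP; split; lra.
Qed.

Lemma deriv_on0_constant (f g : R -> R) : deriv_on f g ->
  (forall x, a <= x <= b -> g x = 0) ->
  forall x, a <= x <= b -> f x = f a.
Proof.
move=> hf g0 x /andP[]; rewrite le_eqVlt => /predU1P[<-//|ax] xb.
have [c /andP[ac cx] E] := deriv_on_mvt hf (lexx a) ax xb.
apply/eqP; rewrite -subr_eq0 E g0 ?mul0r //.
by apply/andP; split; lra.
Qed.

Lemma zero_on_primitive (f g : R -> R) k c : deriv_on f g -> f c = 0 ->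
  zero_on g k c -> zero_on f k.+1 c.
Proof.
move=> hf fc [d [d0 hd dc dk]].
exists (fun j => if j is j'.+1 then d j' else f); split => //.
- case=> [_|j jk]; last exact: hd.
  by apply: eq_deriv_on hf => // x xab; rewrite d0.
- by case=> [//|j jk]; exact: dc.
Qed.

(** The space enters only through coordinates in the [P j]: [beta] for [F0], and [eta k] for a
    function [H k] whose quotient by [F0] has derivative [Q k]. In this form both scalar fields
    reduce to it. *)
Lemma bernstein_operator_real (n : nat) (P : 'I_n.+1 -> R -> R)
    (F0 F1 : R -> R) (H Q : 'I_n -> R -> R) (W : 'I_n -> R)
    (beta : 'I_n.+1 -> R) (eta : 'I_n -> 'I_n.+1 -> R) :
  (forall k, cont_on (P k)) ->
  (forall k : 'I_n.+1, zero_on (P k) k a) ->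
  (forall k : 'I_n.+1, zero_on (P k) (n - k) b) ->
  (forall k x, a <= x <= b -> 0 <= P k x) ->
  cont_on F0 ->
  (forall x, a <= x <= b -> 0 < F0 x) ->
  (forall x, a <= x <= b -> F0 x = \sum_j beta j * P j x) ->
  (forall k x, a <= x <= b -> H k x = \sum_j eta k j * P j x) ->
  (forall k, deriv_on (fun x => H k x / F0 x) (Q k)) ->
  (forall k : 'I_n, zero_on (Q k) k a) ->
  (forall k : 'I_n, zero_on (Q k) (n.-1 - k) b) ->
  (forall k x, a <= x <= b -> 0 <= Q k x) ->
  deriv_on (fun x => F1 x / F0 x) (fun x => \sum_k W k * Q k x) ->
  (forall k, 0 <= W k) ->
  (forall x y, a <= x <= b -> a <= y <= b -> x < y ->
     F1 x / F0 x < F1 y / F0 y) ->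
  exists t alpha : 'I_n.+1 -> R,
    [/\ forall k, a <= t k <= b,
        t ord0 = a /\ t ord_max = b,
        forall k, 0 < alpha k,
        forall x, a <= x <= b ->
          \sum_k F0 (t k) * alpha k * P k x = F0 x &
        forall x, a <= x <= b ->
          \sum_k F1 (t k) * alpha k * P k x = F1 x].
Proof.
move=> Pc Pa Pb P0 F0c F0pos F0E HE HQ Qa Qb Q0 rD W0 r_inc.
have aab : a <= a <= b by rewrite lexx ltW.
have bab : a <= b <= b by rewrite lexx ltW.
have F0neq x : a <= x <= b -> F0 x != 0 by move=> /F0pos; rewrite lt0r => /andP[].
have /choice[La hLa] k : exists L, 0 < L /\ asym a b (P k) k a L.
  have [L L0 hL] := zero_on_asym aab (fun=> Pc k) (Pa k).
  by exists L; split=> //; rewrite lt0r L0 (asym_ge0 ltab _ hL) //; exact: P0.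
have /choice[Lb hLb] k : exists L, L != 0 /\ asym a b (P k) (n - k) b L.
  by have [L L0 hL] := zero_on_asym bab (fun=> Pc k) (Pb k); exists L.
have La_neq j : La j != 0 by have [] := hLa j; rewrite lt0r => /andP[].
have La_asym j : asym a b (P j) j a (La j) by have [] := hLa j.
have Lb_neq j : Lb j != 0 by have [] := hLb j.
have Lb_asym j : asym a b (P j) (n - j) b (Lb j) by have [] := hLb j.
have ob_inj : injective (fun j : 'I_n.+1 => (n - j)%N).
  move=> i j /= ij; apply: val_inj => /=.
  by rewrite -(@subKn i n) -1?ltnS // ij subKn // -ltnS.
have F0asym c : a <= c <= b -> asym a b F0 0 c (F0 c).
  by move=> cab; move/cont_on_asym: F0c; exact.
pose phi k x := H k x / F0 x; pose psi k x := phi k x - phi k a.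
pose C k := psi k b.
(* The shift [s] is [0] for the zero of [psi k] at [a] and [C k] for the zero of [psi k - C k] at
   [b]. *)
have psiD k s : deriv_on (fun x => psi k x - s) (Q k).
  have := deriv_onD (HQ k) (deriv_on_cst (- phi k a - s)).
  by apply: eq_deriv_on => // x _; rewrite ?addr0 // /psi addrA.
have psi_a k : psi k a = 0 by rewrite /psi subrr.
have psi_ge0 k x : a <= x <= b -> 0 <= psi k x.
  move=> /andP[ax xb]; have := deriv_on_nondecreasing (psiD k 0) (Q0 k) (lexx a) ax xb.
  by rewrite !subr0 psi_a.
have psi_at_a k : exists2 L, 0 < L & asym a b (psi k) k.+1 a L.
  have psi0 : zero_on (psi k) k.+1 a.
    apply: zero_on_primitive (Qa k) => //.
    by apply: eq_deriv_on (psiD k 0) => // x _; rewrite subr0.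
  have [//|L L0 hL] := zero_on_asym aab _ psi0.
  by exists L => //; rewrite lt0r L0 (asym_ge0 ltab _ hL) //; exact: psi_ge0.
have psi_at_b (k : 'I_n) : exists L, asym a b (fun x => psi k x - C k) (n - k) b L.
  have psi0 : zero_on (fun x => psi k x - C k) (n.-1 - k).+1 b.
    by apply: zero_on_primitive (Qb k) => //; rewrite /C subrr.
  have [//|L _ hL] := zero_on_asym bab _ psi0.
  (* Integration raises the order [n.-1 - k] by one, which gives [n - k] because [k < n]. *)
  exists L; suff -> : (n - k)%N = (n.-1 - k).+1 by [].
  have nK := ltn_predK (ltn_ord k).
  by rewrite -subSn ?nK // -ltnS nK.
have C_gt0 k : 0 < C k.
  (* If [C k = 0], the nondecreasing [psi k] is squeezed to zero on the whole interval, against its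
     positive leading coefficient at [a]. *)
  rewrite lt0r psi_ge0 // andbT; apply/eqP => Ck.
  have [L L0 hL] := psi_at_a k.
  have : asym a b (psi k) k.+1 a 0.
    apply: eq_asym (asym_cst0 _ _ _ _) => x /andP[ax xb].
    apply/esym/le_anti; rewrite psi_ge0 ?ax // andbT.
    have := deriv_on_nondecreasing (psiD k 0) (Q0 k) ax xb (lexx b).
    by rewrite !subr0 -/(C k) Ck.
  by move/(asym_uniq ltab aab hL) => L00; rewrite L00 ltxx in L0.
pose u k j := eta k j - phi k a * beta j.
have uE k x : a <= x <= b -> F0 x * psi k x = \sum_j u k j * P j x.
  move=> xab.
  have -> : F0 x * psi k x = H k x - phi k a * F0 x.
    by rewrite /psi /phi; field; rewrite !F0neq.
  rewrite HE // F0E // mulr_sumr -sumrB; apply: eq_bigr => j _.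
  by rewrite /u; ring.
have u_lo (k : 'I_n) (j : 'I_n.+1) : (j <= k)%N -> u k j = 0.
  move=> jk; have [L _ hL] := psi_at_a k.
  have := asymM (F0asym a aab) hL => /(eq_asym (uE k)) h.
  exact: (asym_coef0 ltab aab val_inj La_asym La_neq h).
(* At [b], [F0 * (psi k - C k)] has order at least [n - k], while [P j] with [k < j] has the smaller
   order [n - j]; its coefficient is therefore zero. *)
have u_hi (k : 'I_n) (j : 'I_n.+1) : (k < j)%N -> u k j = C k * beta j.
  move=> kj; have [L hL] := psi_at_b k.
  have h : asym a b (fun x => \sum_i (u k i - C k * beta i) * P i x) (n - k) b (F0 b * L).
    apply: eq_asym (asymM (F0asym b bab) hL) => x xab.
    rewrite mulrBr uE // [F0 x]F0E // mulr_suml -sumrB.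
    by apply: eq_bigr => j' _; ring.
  apply/eqP; rewrite -subr_eq0; apply/eqP.
  apply: (asym_coef0 ltab bab ob_inj Lb_asym Lb_neq h).
  by rewrite ltn_sub2l // (leq_trans kj) // -ltnS.
have beta_gt0 j : 0 < beta j.
  (* For [j = k + 1], the leading coefficient of [F0 * psi k] at [a] is positive and equals
     [C k * beta j * La j]. For [j = 0], the value [F0 a] plays this part. *)
  case: (unliftP ord0 j) => [k ->|->].
    have [L L0 hL] := psi_at_a k.
    have h := eq_asym (uE k) (asymM (F0asym a aab) hL).
    have lo i : (val i < val (lift ord0 k))%N -> u k i = 0.
      by rewrite /= ltnS; exact: u_lo.
    have E : F0 a * L = u k (lift ord0 k) * La (lift ord0 k).
      have h' := asym_leading_coef val_inj La_asym lo.
      exact: (asym_uniq ltab aab h h').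
    have : 0 < u k (lift ord0 k) * La (lift ord0 k) by rewrite -E mulr_gt0 // F0pos.
    rewrite u_hi ?lift0 // pmulr_lgt0 ?pmulr_rgt0 //.
    by have [] := hLa (lift ord0 k).
  have h := eq_asym F0E (F0asym a aab).
  have lo (i : 'I_n.+1) : (val i < val (@ord0 n))%N -> beta i = 0 by [].
  have E : F0 a = beta ord0 * La ord0.
    have h' := asym_leading_coef val_inj La_asym lo.
    exact: (asym_uniq ltab aab h h').
  have : 0 < beta ord0 * La ord0 by rewrite -E F0pos.
  by rewrite pmulr_lgt0 //; have [] := hLa ord0.
pose r x := F1 x / F0 x.
(* The expansion of [F0 * psi k] contains [P j] only for [k < j], with coefficient [C k * beta j];
   hence the restricted sum. *)
pose rho (j : 'I_n.+1) := r a + \sum_(k < n | (k < j)%N) W k * C k.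
have rE x : a <= x <= b -> r x = r a + \sum_k W k * psi k x.
  move=> xab.
  have hD : deriv_on (fun x => r x + - 1 * \sum_k W k * psi k x) (fun=> 0).
    have := deriv_on_sum (fun k => deriv_onZ (W k) (psiD k 0)).
    move/(deriv_onZ (- 1))/(deriv_onD rD); apply: eq_deriv_on => y _.
      by congr (_ + _ * _); apply: eq_bigr => k _; rewrite subr0.
    by rewrite mulN1r subrr.
  have := deriv_on0_constant hD (fun _ _ => erefl) xab.
  rewrite [X in _ = _ + _ * X]big1 => [|k _]; last by rewrite psi_a mulr0.
  by lra.
have F1E x : a <= x <= b -> F1 x = \sum_j rho j * beta j * P j x.
  move=> xab.
  have -> : F1 x = r a * F0 x + \sum_k W k * (F0 x * psi k x).
    have -> : \sum_k W k * (F0 x * psi k x) = F0 x * \sum_k W k * psi k x.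
      by rewrite mulr_sumr; apply: eq_bigr => k _; ring.
    have -> : \sum_k W k * psi k x = r x - r a by rewrite (rE x) //; ring.
    by rewrite /r; field; rewrite !F0neq.
  under eq_bigr => k _ do rewrite uE // mulr_sumr.
  rewrite exchange_big F0E // mulr_sumr -big_split /=; apply: eq_bigr => j _.
  rewrite /rho !mulrDl mulrA; congr (_ + _).
  rewrite !mulr_suml [RHS]big_mkcond; apply: eq_bigr => k _.
  by case: ltnP => [kj|jk]; [rewrite u_hi|rewrite u_lo]; rewrite // ?mul0r ?mulr0 //; ring.
have WC k : 0 <= W k * C k by rewrite mulr_ge0 ?W0 // ltW.
have rho0 : rho ord0 = r a by rewrite /rho big_pred0 ?addr0.
have rho_max : rho ord_max = r b.
  rewrite rE //; congr (_ + _); apply: eq_bigl => k /=.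
  exact: ltn_ord.
have rho_ge j : r a <= rho j by rewrite lerDl sumr_ge0.
have rho_le j : rho j <= r b.
  rewrite rE // lerD2l [leLHS]big_mkcond; apply: ler_sum => k _.
  by case: ifP => _ //; exact: WC.
have /choice[t ht] j : exists x, a <= x <= b /\ r x = rho j.
  have ab := ltW ltab.
  have rab : r a <= r b by exact: le_trans (rho_ge ord0) (rho_le ord0).
  have [||x] := @IVT R r a b (rho j) ab.
  - exact: cont_on_within (deriv_on_cont rD).
  - by rewrite (min_idPl rab) (max_idPr rab) rho_ge rho_le.
  by rewrite in_itv /= => xab rx; exists x.
have tab j : a <= t j <= b by have [] := ht j.
have rt j : r (t j) = rho j by have [] := ht j.
(* The intermediate value theorem leaves the choice of preimage open; strict monotonicity forces
   [t ord0 = a] and [t ord_max = b]. *)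
have r_inj x y : a <= x <= b -> a <= y <= b -> r x = r y -> x = y.
  move=> xab yab rxy; have [xy|yx|//] := ltgtP x y.
    by have := r_inc x y xab yab xy; rewrite -/(r x) -/(r y) rxy ltxx.
  by have := r_inc y x yab xab yx; rewrite -/(r x) -/(r y) rxy ltxx.
have betaE j : F0 (t j) * (beta j / F0 (t j)) = beta j.
  by rewrite mulrC divfK // F0neq.
(* These weights give [F0 (t j) * alpha j = beta j], and then [F1 (t j) * alpha j = rho j * beta j]
   because [r (t j) = rho j]. *)
exists t, (fun j => beta j / F0 (t j)); split=> //.
- by split; apply: r_inj; rewrite // rt.
- by move=> k; rewrite divr_gt0 // F0pos.
- by move=> x xab; rewrite F0E //; apply: eq_bigr => k _; rewrite betaE.
- move=> x xab; rewrite F1E //; apply: eq_bigr => k _.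
  by rewrite -rt /r; congr (_ * _); ring.
Qed.

End RealCase.

(** * Change of basis in a space of functions *)

Lemma independent_family_spans (R : realType) (K : numFieldType) (a b : R)
    (V : (R -> K) -> Prop) N (p : 'I_N -> R -> K) :
  has_dim a b V N -> (forall k, V (p k)) ->
  (forall c : 'I_N -> K,
     (forall x, a <= x <= b -> \sum_k c k * p k x = 0) -> forall k, c k = 0) ->
  forall f, V f -> exists c : 'I_N -> K,
    forall x, a <= x <= b -> f x = \sum_k c k * p k x.
Proof.
move=> [e [_ e_free e_span]] Vp p_free f Vf.
have /choice[A hA] k := e_span _ (Vp k).
(* The rows of [M] are the coordinates of the [p k] in the basis [e]. Independence of [p] makes [M]
   invertible, and multiplying by [invmx M] converts coordinates in [e] into coordinates in [p]. *)
pose M := \matrix_(k, l) A k l.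
have comb (v : 'rV[K]_N) x : a <= x <= b ->
    \sum_k v 0 k * p k x = \sum_l (v *m M) 0 l * e l x.
  move=> xab; under eq_bigr => k _ do rewrite hA // mulr_sumr.
  rewrite exchange_big /=; apply: eq_bigr => l _; rewrite mxE mulr_suml.
  by apply: eq_bigr => k _; rewrite mxE mulrA.
have Mu : M \in unitmx.
  rewrite -row_free_unit; apply: inj_row_free => v vM.
  apply/rowP => k; rewrite mxE; apply: p_free => x xab.
  by rewrite comb // vM big1 // => l _; rewrite mxE mul0r.
have [d hd] := e_span f Vf.
exists (fun k => (\row_l d l *m invmx M) 0 k) => x xab.
rewrite comb // mulmxKV // hd //.
by apply: eq_bigr => l _; rewrite mxE.
Qed.

(** * Reduction to real scalars by taking real parts *)

Section Transfer.
Variables (R : realType) (K : numFieldType).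
Variables (iota : {rmorphism R -> K}) (re : {additive K -> R}).
Hypothesis reM : forall r z, re (iota r * z) = r * re z.
Hypothesis re_iota : forall r, re (iota r) = r.
Hypothesis reK : forall z, z \is Num.real -> iota (re z) = z.
Hypothesis le_iota : forall r s, (iota r <= iota s) = (r <= s).
Hypothesis norm_re : forall z, iota `|re z| <= `|z|.

Lemma lt_iota r s : (iota r < iota s) = (r < s).
Proof. by rewrite !lt_def le_iota (inj_eq (fmorph_inj iota)). Qed.

Section Interval.
Variables (a b : R).
Hypothesis ltab : a < b.

(** [re] is additive, commutes with real factors and is bounded by the norm, so it passes through
    limits of difference quotients. The factor [z] allows a rotation before taking real parts. *)
Lemma deriv_on_re z f g : deriv_within iota a b f g ->
  deriv_within (K := R) (fun x : R => x) a b
    (fun x => re (z * f x)) (fun x => re (z * g x)).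
Proof.
move=> hf x xab e e0.
(* The added [1] keeps [m] positive when [z = 0]. *)
pose m := re `|z| + 1.
have zE : `|z| = iota (re `|z|) by rewrite reK // normr_real.
have m0 : 0 < m.
  have : 0 <= re `|z| by rewrite -le_iota -zE rmorph0.
  by rewrite /m; lra.
have [d d0 hd] := hf x xab (e / m) (divr_gt0 e0 m0).
exists d => // y yab ynx yx; have {hd} := hd y yab ynx yx.
set q := _ - g x => hq.
have -> : (re (z * f y) - re (z * f x)) / (y - x) - re (z * g x) = re (z * q).
  rewrite /q mulrBr raddfB /=; congr (_ - _).
  rewrite -raddfB -mulrBr /=.
  by rewrite -fmorphV mulrA mulrC -reM mulrC.
rewrite -lt_iota; apply: le_lt_trans (norm_re _) _.
rewrite normrM; apply: le_lt_trans (_ : iota m * `|q| < _).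
  by rewrite ler_wpM2r // zE le_iota /m; lra.
have -> : e = m * (e / m) by rewrite mulrC divfK // gt_eqF.
by rewrite rmorphM ltr_pM2l // -(rmorph0 iota) lt_iota.
Qed.

Lemma cont_on_re f : cont_within iota a b f ->
  cont_within (K := R) (fun x : R => x) a b (fun x => re (f x)).
Proof.
move=> hf x xab e e0; have [d d0 hd] := hf x xab e e0.
exists d => // y yab yx; rewrite -raddfB -lt_iota.
exact: le_lt_trans (norm_re _) (hd y yab yx).
Qed.

(* The derivatives of a real-valued [f] need not be known to be real: they are
   rotated by [z], the inverse of the first nonzero one, before taking real parts. *)
Lemma zero_on_re f k c : (forall x, a <= x <= b -> f x \is Num.real) ->
  a <= c <= b -> zero_of_order iota a b f k c ->
  zero_of_order (K := R) (fun x : R => x) a b (fun x => re (f x)) k c.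
Proof.
move=> f_real cab [d [d0 hd dc dk]].
pose z := (d k c)^-1; pose e j x := re (z * d j x).
have eD j : (j < k)%N -> deriv_within (K := R) (fun x : R => x) a b (e j) (e j.+1).
  by move=> jk; apply/deriv_on_re/hd.
have e0 x : a <= x <= b -> e 0%N x = re z * re (f x).
  by move=> xab; rewrite /e d0 // -(reK (f_real x xab)) mulrC reM re_iota mulrC.
have ek : e k c = 1 by rewrite /e mulVf // -(rmorph1 iota) re_iota.
(* If [re z] were zero, [e 0] would vanish on the interval and, by uniqueness of derivatives, so
   would each [e j] up to [e k], against [e k c = 1]. *)
have z0 : re z != 0.
  apply/eqP => z0.
  suff e00 j : (j <= k)%N -> forall x, a <= x <= b -> e j x = 0.
    by have /eqP := e00 k (leqnn k) c cab; rewrite ek oner_eq0.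
  elim: j => [_ x xab|j IHj jk]; first by rewrite e0 // z0 mul0r.
  apply: deriv_on_uniq ltab _ _ _ (eD j jk) _.
  by apply: eq_deriv_on (deriv_on_cst 0) => // x xab; rewrite IHj // ltnW.
exists (fun j x => (re z)^-1 * e j x); split.
- by move=> x xab; rewrite e0 // mulKf.
- by move=> j jk; exact/deriv_onZ/eD.
- by move=> j jk; rewrite /e dc // mulr0 raddf0 mulr0.
- by rewrite ek mulr1 invr_eq0.
Qed.

Lemma re_comb (I : finType) (c f : I -> K) :
  (forall i, f i \is Num.real) ->
  re (\sum_i c i * f i) = \sum_i re (c i) * re (f i).
Proof.
move=> f_real; rewrite raddf_sum; apply: eq_bigr => i _ /=.
by rewrite -[in LHS](reK (f_real i)) mulrC reM mulrC.
Qed.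

End Interval.

(** The functions in the conclusion are real-valued on the interval, so the identities proved for
    their real parts can be pushed back through [iota]. *)
Lemma theorem1_transfer : theorem1_for iota.
Proof.
move=> a b n U p f0 f1 q w ltab subU CU dimU Bp p0 Uf0 f00 Uf1 f1_real f1_inc.
move=> Bq q0 f1D w0.
have aab : a <= a <= b by rewrite lexx ltW.
have bab : a <= b <= b by rewrite lexx ltW.
have p_real k x : a <= x <= b -> p k x \is Num.real by move=> xab; rewrite ger0_real ?p0.
have q_real k x : a <= x <= b -> q k x \is Num.real by move=> xab; rewrite ger0_real ?q0.
have f0_real x : a <= x <= b -> f0 x \is Num.real by move=> xab; rewrite gtr0_real ?f00.
have w_real k : w k \is Num.real by rewrite ger0_real ?w0.
have re_ge0 z : 0 <= z -> 0 <= re z.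
  by move=> z0; rewrite -le_iota reK ?rmorph0 // ger0_real.
have U_cont f : U f -> cont_within (K := R) (fun x : R => x) a b (fun x => re (f x)).
  move=> /CU[d [d0 _ dc]]; apply: cont_on_re => x xab e e0.
  have [h h0 hh] := dc 0%N (leq0n n) x xab e e0; exists h => // y yab yx.
  by rewrite -!d0 //; exact: hh.
have Up k : U (p k) by have [] := Bp k.
pose P k x := re (p k x).
have Pa (k : 'I_n.+1) : zero_of_order (K := R) (fun x : R => x) a b (P k) k a.
  by have [_ h _] := Bp k; apply: zero_on_re h => // x; exact: p_real.
have Pb (k : 'I_n.+1) : zero_of_order (K := R) (fun x : R => x) a b (P k) (n - k) b.
  by have [_ _ h] := Bp k; apply: zero_on_re h => // x; exact: p_real.
have p_free (c : 'I_n.+1 -> K) :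
    (forall x, a <= x <= b -> \sum_k c k * p k x = 0) -> forall k, c k = 0.
  move=> hc k.
  have /choice[L hL] j : exists L, L != 0 /\ asym a b (P j) j a L.
    by have [L L0 h] := zero_on_asym aab (fun=> U_cont _ (Up j)) (Pa j); exists L.
  apply/eqP/negPn/negP => ck0.
  (* Division by [c k] turns the coefficient of index [k] into [1], whose real part is nonzero even
     if that of [c k] is not. The zero combination is negligible at order [n.+1], above every order
     [j <= n]. *)
  have h : asym a b (fun x => \sum_j re ((c k)^-1 * c j) * P j x) n.+1 a 0.
    apply: eq_asym (asym_cst0 _ _ _ _) => x xab.
    rewrite -re_comb => [|j]; last exact: p_real.
    under eq_bigr => j _ do rewrite -mulrA.
    by rewrite -mulr_sumr hc // mulr0 raddf0.
  have := asym_coef0 ltab aab val_inj (fun j => proj2 (hL j)) (fun j => proj1 (hL j)) h.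
  move=> /(_ k (ltn_ord k)); rewrite mulVf // -(rmorph1 iota) re_iota => /eqP.
  by rewrite oner_eq0.
have U_span f : U f -> exists c : 'I_n.+1 -> R,
    forall x, a <= x <= b -> re (f x) = \sum_k c k * P k x.
  move=> /(independent_family_spans dimU Up p_free)[c hc].
  exists (fun k => re (c k)) => x xab; rewrite hc // re_comb // => k.
  exact: p_real.
have re_div f x : a <= x <= b -> re (f x / f0 x) = re (f x) / re (f0 x).
  move=> xab; rewrite -[f0 x in LHS]reK ?f0_real // -fmorphV.
  by rewrite mulrC reM mulrC.
have re_deriv f g : deriv_within iota a b (fun x => f x / f0 x) g ->
    deriv_within (K := R) (fun x : R => x) a b
      (fun x => re (f x) / re (f0 x)) (fun x => re (g x)).
  move=> /(deriv_on_re 1); apply: eq_deriv_on => x xab; rewrite mul1r //.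
  exact: re_div.
(* [h k] may take non-real values; only its real part enters the real statement. *)
have /choice[h hq] k : exists h, U h /\ deriv_within iota a b (fun x => h x / f0 x) (q k).
  by have [[h Uh hD] _ _] := Bq k; exists h.
have [beta betaE] := U_span _ Uf0.
have /choice[eta etaE] k := U_span _ (proj1 (hq k)).
have [|||||||||||||||t [alpha [tab tE alpha0 E0 E1]]] :=
  @bernstein_operator_real R a b ltab n P (fun x => re (f0 x)) (fun x => re (f1 x))
    (fun k x => re (h k x)) (fun k x => re (q k x)) (fun k => re (w k)) beta eta.
- by move=> k; exact: U_cont.
- exact: Pa.
- exact: Pb.
- by move=> k x xab; apply/re_ge0/p0.
- exact: U_cont.
- by move=> x xab; rewrite -lt_iota reK ?f0_real // rmorph0 f00.
- exact: betaE.
- exact: etaE.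
- by move=> k; apply/re_deriv/(proj2 (hq k)).
- by move=> k; have [_ hk _] := Bq k; apply: zero_on_re hk => // x; exact: q_real.
- by move=> k; have [_ _ hk] := Bq k; apply: zero_on_re hk => // x; exact: q_real.
- by move=> k x xab; apply/re_ge0/q0.
- apply: eq_deriv_on (re_deriv _ _ f1D) => // x xab.
  by rewrite re_comb // => k; exact: q_real.
- by move=> k; exact/re_ge0/w0.
- move=> x y xab yab xy; rewrite -!re_div // -lt_iota !reK ?f1_inc //;
    by rewrite realM ?realV ?f0_real ?f1_real.
have bern_re f x : (forall y, a <= y <= b -> f y \is Num.real) -> a <= x <= b ->
    bern_op iota t alpha p f x = iota (\sum_k re (f (t k)) * alpha k * P k x).
  move=> f_real xab; rewrite rmorph_sum; apply: eq_bigr => k _.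
  by rewrite !rmorphM reK ?f_real // reK // p_real.
exists t, alpha; split=> // x xab.
- by rewrite bern_re // E0 // reK // f0_real.
- by rewrite bern_re // E1 // reK // f1_real.
Qed.

End Transfer.

(* K = R (iota = id) and K = C = R[i] (iota = real embedding x |-> x%:C). *)
Theorem theorem1 (R : realType) :
  theorem1_for (K := R) (fun x : R => x) /\
  theorem1_for (K := R[i]%C) (@real_complex R).
Proof.
split.
  exact: (@theorem1_transfer R R idfun idfun).
apply: (@theorem1_transfer R R[i]%C (@real_complex R) (@complex.Re R)).
- by move=> r [x y] /=; rewrite mul0r subr0.
- by [].
- exact: RRe_real.
- exact: lecR.
- exact: normc_ge_Re.
Qed.
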